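(* Let $G$ be a finite group and $k$ a field of characteristic $0$, and let $K$-theory be taken with coefficients in $k$. Then as algebras $$K_{global}(I(pt,G),G)=D(k[G])^{\rm comm}.$$
   Context: $D(k[G])$ is the Drinfel'd double of the group ring: it has $k$-basis $g\llcorner x$, $g,x\in G$, and product $(g\llcorner x)(h\llcorner y)=\delta_{g,xhx^{-1}}\,g\llcorner xy$. $D(k[G])^{\rm comm}$ is the subalgebra spanned by the $g\llcorner x$ with $gx=xg$ (it is all of $D(k[G])$ if $G$ is Abelian). For a finite group $H$ acting on $Y$, $K_{global}(Y,H)=\bigoplus_{m\in H}K(Y^m)$ with the stringy product $v_{m_1}*v_{m_2}=\check e_{3*}(e_1^*(v_{m_1})e_2^*(v_{m_2})\,\mathrm{Eu}(\mathcal R(\mathbf m)))$. Here $\mathbf m=(m_1,m_2,m_3)$ with $m_3=(m_1m_2)^{-1}$; $e_i:Y^{\langle m_1,m_2\rangle}\to Y^{m_i}$ and $\check e_3:Y^{\langle m_1,m_2\rangle}\to Y^{m_1m_2}$ are the inclusions; $\mathrm{Eu}(E)=\lambda_{-1}(E^* )$; and $\mathcal R(\mathbf m)=S_{m_1}\oplus S_{m_2}\oplus S_{m_3}\ominus N_{Y^{\langle m_1,m_2\rangle}/Y}$, where $S_m=\bigoplus_j\frac jrW_{m,j}$, $r=\mathrm{ord}(m)$, $W_{m,j}\subset TY|_{Y^m}$ the $\exp(2\pi ij/r)$-eigenbundle of $m$ (for zero-dimensional $Y$ these bundles vanish). $I(X,G)=\coprod_{g\in G}X^g$ is the inertia variety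 with the $G$-action $h:X^g\to X^{hgh^{-1}}$; $I(pt,G)$ is the case $X=pt$ with trivial $G$-action, i.e. the set $G$ with conjugation. *)

(* Defs.v *)
From HB Require Import structures.
From mathcomp Require Import all_boot all_order all_algebra all_fingroup all_field.
From mathcomp Require Import finmap complex.
From mathcomp Require Import mathcomp_extra boolp classical_sets reals trigo.
From mathcomp.multinomials Require Import monalg.

Set Implicit Arguments.
Unset Strict Implicit.
Unset Printing Implicit Defensive.

Import GRing.Theory.

Local Open Scope ring_scope.

(* A function a : G * G -> k stands for \sum a (g, x) g|_x, where g|_x is the
   basis vector attached to (g, x). *)
Definition drinfeld (k : fieldType) (G : finGroupType) := {ffun G * G -> k^o}.

Section DrinfeldDouble.
Variables (k : fieldType) (G : finGroupType).
Local Notation D := (drinfeld k G).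

HB.instance Definition _ := Vector.on D.

Definition dbasis (g x : G) : D := [ffun p => (p == (g, x))%:R].

(* The bilinear extension of
   (g|_x) (h|_y) = \delta_{g, x h x^-1} g|_(x y). *)
Definition dmul (a b : D) : D :=
  \sum_(p : G * G) \sum_(q : G * G)
    (a p * b q * (p.1 == p.2 * q.1 * p.2^-1)%g%:R) *: dbasis p.1 (p.2 * q.2)%g.

Definition dunit : D := \sum_(g : G) dbasis g 1%g.

Lemma dmulE a b g z :
  dmul a b (g, z) = \sum_(x : G) a (g, x) * b ((g ^ x)%g, (x^-1 * z)%g).
Proof.
rewrite /dmul sum_ffunE.
transitivity (\sum_(g1 : G) \sum_(x : G) \sum_(q : G * G)
   a (g1, x) * b q * (g1 == x * q.1 * x^-1)%g%:R * ((g, z) == (g1, x * q.2)%g)%:R).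
  rewrite pair_big /=; apply: eq_bigr => -[g1 x] _.
  by rewrite sum_ffunE; apply: eq_bigr => q _; rewrite !ffunE.
rewrite (bigD1 g) //= [X in _ + X]big1 ?addr0 => [|g1 gg1]; last first.
  rewrite big1 // => x _; rewrite big1 // => q _.
  by rewrite xpair_eqE [g == g1]eq_sym (negPf gg1) mulr0.
apply: eq_bigr => x _; rewrite (bigD1 ((g ^ x)%g, (x^-1 * z)%g)) //=.
rewrite big1 ?addr0 => [|[h y] /=].
  by rewrite conjgE !mulgA !(mulgK, mulgV, mul1g) !eqxx !mulr1.
rewrite xpair_eqE negb_and => /orP[hN|yN].
  have -> : (g == x * h * x^-1)%g = false; last by rewrite mulr0 mul0r.
  by apply: contraNF hN => /eqP->; rewrite conjgE !mulgA mulVg mul1g mulgKV.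
have -> : ((g, z) == (g, x * y)%g) = false; last by rewrite mulr0.
by apply: contraNF yN; rewrite xpair_eqE eqxx /= => /eqP->; rewrite mulKg.
Qed.

Lemma dunitE g x : dunit (g, x) = (x == 1%g)%:R.
Proof.
rewrite /dunit sum_ffunE (bigD1 g) //= big1 ?addr0 => [|h hg].
  by rewrite ffunE xpair_eqE eqxx.
by rewrite ffunE xpair_eqE [g == h]eq_sym (negPf hg).
Qed.

Lemma dmulA : associative dmul.
Proof.
move=> a b c; apply/ffunP => -[g z]; rewrite !dmulE.
under eq_bigr => x _ do rewrite dmulE mulr_sumr.
under [RHS]eq_bigr => x _ do rewrite dmulE mulr_suml.
rewrite [RHS]exchange_big /=; apply: eq_bigr => x _.
rewrite [RHS](reindex_inj (mulgI x)) /=; apply: eq_bigr => y _.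
by rewrite mulKg mulrA conjgM invMg mulgA.
Qed.

Lemma dmul1 : left_id dunit dmul.
Proof.
move=> a; apply/ffunP => -[g z]; rewrite dmulE (bigD1 1%g) //= big1.
  by rewrite addr0 dunitE eqxx mul1r conjg1 invg1 mul1g.
by move=> x /negPf x1; rewrite dunitE x1 mul0r.
Qed.

Lemma dmulr1 : right_id dunit dmul.
Proof.
move=> a; apply/ffunP => -[g z]; rewrite dmulE (bigD1 z) //= big1.
  by rewrite addr0 dunitE mulVg eqxx mulr1.
by move=> x xz; rewrite dunitE -eq_mulVg1 (negPf xz) mulr0.
Qed.

Lemma dmulDl : left_distributive dmul +%R.
Proof.
move=> a b c; apply/ffunP => -[g z]; rewrite ffunE !dmulE -big_split /=.
by apply: eq_bigr => x _; rewrite ffunE mulrDl.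
Qed.

Lemma dmulDr : right_distributive dmul +%R.
Proof.
move=> a b c; apply/ffunP => -[g z]; rewrite ffunE !dmulE -big_split /=.
by apply: eq_bigr => x _; rewrite ffunE mulrDr.
Qed.

Lemma dunit_neq0 : dunit != 0.
Proof.
apply/eqP => /ffunP/(_ (1, 1)%g); rewrite dunitE eqxx ffunE => /eqP.
by rewrite oner_eq0.
Qed.

HB.instance Definition _ := GRing.Zmodule_isNzRing.Build D
  dmulA dmul1 dmulr1 dmulDl dmulDr dunit_neq0.

Lemma dscaleAl (c : k) (a b : D) : c *: (a * b) = (c *: a) * b.
Proof.
apply/ffunP => -[g z]; rewrite ffunE !dmulE scaler_sumr.
by apply: eq_bigr => x _; rewrite ffunE -scalerAl.
Qed.

HB.instance Definition _ := GRing.Lmodule_isLalgebra.Build k D dscaleAl.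

Lemma dscaleAr (c : k) (a b : D) : c *: (a * b) = a * (c *: b).
Proof.
apply/ffunP => -[g z]; rewrite ffunE !dmulE scaler_sumr.
by apply: eq_bigr => x _; rewrite ffunE -scalerAr.
Qed.

HB.instance Definition _ := GRing.Lalgebra_isAlgebra.Build k D dscaleAr.
HB.instance Definition _ := Algebra_isFalgebra.Build k D.

Lemma dbasisM g x h y :
  dbasis g x * dbasis h y = (g == x * h * x^-1)%g%:R *: dbasis g (x * y)%g.
Proof.
rewrite /GRing.mul /= /dmul (bigD1 (g, x)) //= [X in _ + X]big1 ?addr0.
  rewrite (bigD1 (h, y)) //= [X in _ + X]big1 ?addr0.
    by rewrite !ffunE !eqxx !mul1r.
  by move=> q /negPf qN; rewrite [dbasis h y q]ffunE qN mulr0 mul0r scale0r.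
move=> p /negPf pN; apply: big1 => q _.
by rewrite [dbasis g x p]ffunE pN !mul0r scale0r.
Qed.

Definition dcomm_basis : seq D :=
  [seq dbasis p.1 p.2 | p in [pred p : G * G | (p.1 * p.2 == p.2 * p.1)%g]].

Lemma mem_dcomm (a : D) :
  reflect (forall g x, (g * x != x * g)%g -> a (g, x) = 0)
    (a \in <<dcomm_basis>>%VS).
Proof.
apply: (iffP idP) => [|a0]; last first.
  have -> : a = \sum_(p : G * G) a p *: dbasis p.1 p.2.
    apply/ffunP => q; rewrite sum_ffunE (bigD1 q) //= big1 => [|p pq].
      by rewrite addr0 !ffunE -surjective_pairing eqxx [_ *: _]mulr1.
    by rewrite !ffunE -surjective_pairing eq_sym (negPf pq) [_ *: _]mulr0.
  apply: rpred_sum => -[g x] _.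
  have [gx|/a0->] := eqVneq (g * x)%g (x * g)%g; last by rewrite scale0r mem0v.
  apply/memvZ/memv_span.
  by apply/mapP; exists (g, x); rewrite ?mem_enum ?inE /= ?gx.
move=> aD g x gx; rewrite (coord_span (X := in_tuple dcomm_basis) aD).
rewrite sum_ffunE big1 // => i _; rewrite ffunE.
have /mapP[[h y] + ->] := mem_nth 0 (ltn_ord i).
rewrite mem_enum inE /= ffunE xpair_eqE => /eqP hy.
have [/andP[/eqP gh /eqP xy]|] := boolP (_ && _); last by rewrite [_ *: _]mulr0.
by move: gx; rewrite gh xy hy eqxx.
Qed.

Lemma dcomm_is_aspace : is_aspace <<dcomm_basis>>%VS.
Proof.
rewrite /is_aspace has_algid1 /=; last first.
  apply/mem_dcomm => g x; rewrite dunitE; have [->|//] := eqVneq x 1%g.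
  by rewrite mulg1 mul1g eqxx.
apply/prodvP => a b /mem_dcomm aP /mem_dcomm bP; apply/mem_dcomm => g z gz.
rewrite [_ * _](_ : _ = dmul a b) // dmulE big1 // => x _.
have [gx|/aP->] := eqVneq (g * x)%g (x * g)%g; last by rewrite mul0r.
have gxE : (g ^ x = g)%g by rewrite conjgE gx mulKg.
rewrite gxE bP ?mulr0 //; apply: contra gz => /eqP gz.
by apply/eqP; rewrite -(mulKVg x z); apply: commuteM.
Qed.

(* The subalgebra D(k[G])^comm; it contains the unit of D(k[G]). *)
Definition dcomm : {aspace D} := ASpace dcomm_is_aspace.
End DrinfeldDouble.

(* A zero-dimensional complex variety is a finite set Y of reduced points, and
   a vector bundle on it is a family of finite-dimensional complex vector
   spaces indexed by Y. K-theory only depends on bundles up to isomorphism, so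
   we work in the equivalent small category of the families of coordinate
   spaces C^n: the universe levels of vectType do not allow a quotient of a
   type of arbitrary families Y -> vectType C to be a zmodType. *)

Record vbundle (R : realType) (Y : Type) := VBundle { vb_rank : Y -> nat }.

HB.instance Definition _ R Y := gen_eqMixin (vbundle R Y).
HB.instance Definition _ R Y := gen_choiceMixin (vbundle R Y).

Section VectorBundles.
Variables (R : realType).
Local Notation C := R[i]%C.

Definition fiber (Y : Type) (E : vbundle R Y) (y : Y) : vectType C :=
  'rV[C]_(vb_rank E y).
Local Coercion fiber : vbundle >-> Funclass.

(* The bundle isomorphic to the family V, obtained by choosing a basis of each
   V y. *)
Definition vb_of (Y : Type) (V : Y -> vectType C) : vbundle R Y :=
  VBundle R (fun y => \dim {: V y}).

Definition vb_trivial (Y : Type) (V : vectType C) : vbundle R Y :=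
  vb_of (fun=> V).

Definition vb_pullback (Z Y : Type) (f : Z -> Y) (E : vbundle R Y) :
    vbundle R Z :=
  vb_of (fun z => E (f z)).

(* The pushforward along an inclusion f of finite sets is extension by zero. *)
Definition vb_pushforward (Z Y : finType) (f : Z -> Y) (E : vbundle R Z) :
    vbundle R Y :=
  vb_of (fun y => if [pick z | f z == y] is Some z then E z
                  else ('rV[C]_0 : vectType C)).

Definition vb_dual (Y : Type) (E : vbundle R Y) : vbundle R Y :=
  vb_of (fun y => 'Hom(E y, C^o)).

(* For finite-dimensional V and W, the tensor product of V and W is
   Hom(V^*, W). *)
Definition vb_tensor (Y : Type) (E F : vbundle R Y) : vbundle R Y :=
  vb_of (fun y => 'Hom('Hom(E y, C^o), F y)).

(* The i-th exterior power of V has the basis e_{s_1} /\ ... /\ e_{s_i}, where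
   {s_1 < ... < s_i} runs over the i-element subsets of a basis of V. *)
Definition vb_ext (Y : Type) i (E : vbundle R Y) : vbundle R Y :=
  vb_of (fun y => {ffun {s : {set 'I_(\dim {: E y})} | #|s| == i} -> C^o}).

Definition short_exact (Y : Type) (E' E E'' : vbundle R Y) : Prop :=
  forall y, exists i : 'Hom(E' y, E y), exists p : 'Hom(E y, E'' y),
    [/\ lker i = 0%VS, limg i = lker p & limg p = fullv].

End VectorBundles.

Coercion fiber : vbundle >-> Funclass.

Section KTheory.
Variables (R : realType) (k : fieldType).

Section Group.
Variable Y : Type.
Local Notation Vb := (vbundle R Y).

(* The subspace of the free k-module on vector bundles spanned by
   [E] - [E'] - [E''] for 0 -> E' -> E -> E'' -> 0 exact. *)
Inductive Krel : {malg k[Vb]} -> Prop :=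
| Krel0 : Krel 0
| KrelS c (E' E E'' : Vb) x : short_exact E' E E'' -> Krel x ->
    Krel (c *: (<< E >> - << E' >> - << E'' >>) + x).

Definition Krel_pred : {pred {malg k[Vb]}} := fun x => `[< Krel x >].

Lemma KrelD x y : Krel x -> Krel y -> Krel (x + y).
Proof.
by move=> Kx Ky; elim: Kx => [|c E' E E'' z e _ IH];
  rewrite ?add0r // -addrA; constructor.
Qed.

Lemma KrelZ c x : Krel x -> Krel (c *: x).
Proof.
elim=> [|d E' E E'' z e _ IH]; first by rewrite scaler0; constructor.
by rewrite scalerDr scalerA; constructor.
Qed.

Lemma Krel_zmod_closed : zmod_closed Krel_pred.
Proof.
split=> [|x y /asboolP Kx /asboolP Ky]; first by apply/asboolP; constructor.
by apply/asboolP/KrelD => //; rewrite -scaleN1r; exact: KrelZ.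
Qed.

HB.instance Definition _ := GRing.isZmodClosed.Build _ Krel_pred Krel_zmod_closed.

(* The Grothendieck group of vector bundles on Y, with coefficients in k. *)
Definition Kth := @Quotient.quot {malg k[Vb]} Krel_pred.

HB.instance Definition _ := GRing.Zmodule.on Kth.

Definition Kpi (x : {malg k[Vb]}) : Kth := \pi_Kth%qT x.

Lemma KpiD : {morph Kpi : x y / x + y}.
Proof. exact: raddfD. Qed.

Lemma Kpi_eq x y : Kpi x = Kpi y <-> Krel (x - y).
Proof.
split=> [/eqP|xy]; first by rewrite -Quotient.idealrBE => /asboolP.
by apply/eqP; rewrite -Quotient.idealrBE; apply/asboolP.
Qed.

Definition Krepr (x : Kth) : {malg k[Vb]} := generic_quotient.repr x.

Lemma KreprK x : Kpi (Krepr x) = x.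
Proof. exact: reprK. Qed.

Definition Kscale (c : k) (x : Kth) : Kth := Kpi (c *: Krepr x).

Lemma KscaleE c x : Kscale c (Kpi x) = Kpi (c *: x).
Proof.
apply/Kpi_eq; rewrite -scalerBr; apply/KrelZ/Kpi_eq.
exact: KreprK.
Qed.

Lemma KpiP (x : Kth) : exists y, x = Kpi y.
Proof. by exists (Krepr x); rewrite KreprK. Qed.

Lemma KscaleA c d x : Kscale c (Kscale d x) = Kscale (c * d) x.
Proof. by have [y ->] := KpiP x; rewrite !KscaleE scalerA. Qed.

Lemma Kscale1 : left_id 1 Kscale.
Proof. by move=> x; have [y ->] := KpiP x; rewrite KscaleE scale1r. Qed.

Lemma KscaleDr : right_distributive Kscale +%R.
Proof.
move=> c x y; have [x' ->] := KpiP x; have [y' ->] := KpiP y.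
by rewrite -KpiD !KscaleE scalerDr KpiD.
Qed.

Lemma KscaleDl x : {morph Kscale^~ x : c d / c + d}.
Proof.
by move=> c d /=; have [y ->] := KpiP x; rewrite !KscaleE scalerDl KpiD.
Qed.

HB.instance Definition _ :=
  GRing.Zmodule_isLmodule.Build k Kth KscaleA Kscale1 KscaleDr KscaleDl.

Definition Kclass (E : Vb) : Kth := Kpi << E >>.

Definition additive_on_exact (M : lmodType k) (phi : Vb -> M) : Prop :=
  forall E' E E'', short_exact E' E E'' -> phi E = phi E' + phi E''.

(* The k-linear map induced by phi; it does not depend on the representative
   if phi is additive on exact sequences, see Klift_pi. *)
Definition Klift (M : lmodType k) (phi : Vb -> M) (x : Kth) : M :=
  \sum_(E <- msupp (Krepr x)) (Krepr x)@_E *: phi E.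

Section Lift.
Variables (M : lmodType k) (phi : Vb -> M).
Local Notation ext x := (\sum_(E <- msupp x) x@_E *: phi E).

Lemma ext_sub (A : {fset Vb}) (x : {malg k[Vb]}) :
  (msupp x `<=` A)%fset -> ext x = \sum_(E <- A) x@_E *: phi E.
Proof.
move=> xA; apply: big_fset_incl => // E _ xE.
by rewrite mcoeff_outdom // scale0r.
Qed.

Lemma ext_linear c (x y : {malg k[Vb]}) : ext (c *: x + y) = c *: ext x + ext y.
Proof.
pose A := (msupp x `|` msupp y `|` msupp (c *: x + y))%fset.
rewrite (@ext_sub A x) ?(@ext_sub A y) ?(@ext_sub A (c *: x + y));
  try by apply/fsubsetP => E; rewrite !inE => ->; rewrite ?orbT.
rewrite scaler_sumr -big_split /=; apply: eq_bigr => E _.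
by rewrite mcoeffD mcoeffZ scalerDl scalerA.
Qed.

Lemma ext_U E : ext (<< E >> : {malg k[Vb]}) = phi E.
Proof. by rewrite msuppU oner_eq0 big_seq_fset1 mcoeffUU scale1r. Qed.

Hypothesis phiD : additive_on_exact phi.

Lemma ext_rel x : Krel x -> ext x = 0.
Proof.
elim=> [|c E' E E'' z e _ IH]; first by rewrite msupp0 big_seq_fset0.
rewrite ext_linear IH addr0 -addrA addrC -opprD -scaleN1r ext_linear ext_U.
rewrite -[<< E' >>]scale1r ext_linear !ext_U (phiD e).
by rewrite scale1r scaleN1r addNr scaler0.
Qed.

Lemma Klift_pi x : Klift phi (Kpi x) = ext x.
Proof.
have /Kpi_eq/ext_rel := KreprK (Kpi x).
by rewrite addrC -scaleN1r ext_linear scaleN1r addrC => /subr0_eq.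
Qed.

Lemma Klift_class E : Klift phi (Kclass E) = phi E.
Proof. by rewrite Klift_pi ext_U. Qed.

Lemma Klift_linear : linear (Klift phi).
Proof.
move=> c x y; have [x' ->] := KpiP x; have [y' ->] := KpiP y.
by rewrite -[c *: _]/(Kscale c _) KscaleE -KpiD !Klift_pi ext_linear.
Qed.
End Lift.

Definition Kmul (x y : Kth) : Kth :=
  Klift (fun E => Klift (fun F => Kclass (vb_tensor E F)) y) x.

Definition Kone : Kth := Kclass (vb_trivial Y (R[i]%C)^o).

End Group.

Definition Kpullback (Z Y : Type) (f : Z -> Y) : Kth Y -> Kth Z :=
  Klift (fun E => Kclass (vb_pullback f E)).

Definition Kpushforward (Z Y : finType) (f : Z -> Y) : Kth Z -> Kth Y :=
  Klift (fun E => Kclass (vb_pushforward f E)).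

Section EulerClass.
Variable Y : finType.

Definition lambda_m1 (E : vbundle R Y) : Kth Y :=
  \sum_(i < (\max_y \dim {: E y}).+1) (-1) ^+ i *: Kclass (vb_ext i E).

(* Eu is applied to a virtual bundle x that is the class of a vector bundle E,
   and is then \lambda_{-1}(E^* ). In characteristic 0 the class of E in Kth
   determines E up to isomorphism. *)
Definition Eu (x : Kth Y) : Kth Y :=
  lambda_m1 (vb_dual (xget (vb_trivial Y 'rV[R[i]%C]_0)
    [set E : vbundle R Y | Kclass E = x]%classic)).

End EulerClass.
End KTheory.

(* Left actions; the actions of the library are right actions. *)
Record laction (H : finGroupType) (Y : finType) := LAction {
  lact :> H -> Y -> Y;
  lact1 : forall y, lact 1%g y = y;
  lactM : forall g h y, lact (g * h)%g y = lact g (lact h y) }.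

Definition trivial_laction (H : finGroupType) (Y : finType) : laction H Y :=
  @LAction H Y (fun _ y => y) (fun _ => erefl) (fun _ _ _ => erefl).

Section Inertia.
Variables (G : finGroupType) (X : finType) (act : laction G X).

(* The disjoint union of the X^g: the pairs (g, x) with x in X^g. *)
Definition inertia := {p : G * X | act p.1 p.2 == p.2}.

HB.instance Definition _ := Finite.on inertia.

Lemma inertia_subproof (h : G) (p : inertia) :
  act ((val p).1 ^ h^-1)%g (act h (val p).2) == act h (val p).2.
Proof.
case: p => -[g x] /= /eqP gx.
by rewrite conjgE invgK -lactM !mulgA mulgKV lactM gx.
Qed.

(* h : X^g -> X^(h g h^-1); note that g ^ h^-1 = h * g * h^-1. *)
Definition inertia_act (h : G) (p : inertia) : inertia :=
  exist _ ((val p).1 ^ h^-1, act h (val p).2)%g (inertia_subproof h p).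

Lemma inertia_act1 p : inertia_act 1%g p = p.
Proof.
by apply: val_inj; case: p => -[g x] /= _; rewrite invg1 conjg1 lact1.
Qed.

Lemma inertia_actM g h p :
  inertia_act (g * h)%g p = inertia_act g (inertia_act h p).
Proof.
by apply: val_inj; case: p => -[m x] /= _; rewrite invMg conjgM lactM.
Qed.

Definition inertia_laction : laction G inertia :=
  LAction inertia_act1 inertia_actM.

End Inertia.

Section FixedPoints.
Variables (H : finGroupType) (Y : finType) (act : laction H Y).

Definition fixpt (A : {set H}) := {y : Y | [forall h in A, act h y == y]}.

HB.instance Definition _ (A : {set H}) := Finite.on (fixpt A).

Lemma fixpt_incl_subproof (A B : {set H}) (sBA : B \subset A) (y : fixpt A) :
  [forall h in B, act h (val y) == val y].
Proof.
apply/forall_inP => h hB.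
by have /forall_inP/(_ h (fintype.subsetP sBA h hB)) := valP y.
Qed.

Definition fixpt_incl (A B : {set H}) (sBA : B \subset A) (y : fixpt A) :
  fixpt B := exist _ (val y) (fixpt_incl_subproof sBA y).

End FixedPoints.

Section Stringy.
Variables (R : realType) (k : fieldType) (H : finGroupType) (Y : finType).
Variable act : laction H Y.
Local Notation C := R[i]%C.
Local Notation "Y ^! A" := (fixpt act A) (at level 30).

(* Tangent spaces of a zero-dimensional variety vanish, so that 0 is the only
   possible value of a differential. *)
Definition tangent : vectType C := 'rV[C]_0.
Definition differential (Z Z' : Type) (f : Z -> Z') (z : Z) : 'End(tangent) := 0.

Definition expi2pi (j r : nat) : C :=
  let t : R := 2 * pi * j%:R / r%:R in (cos t +i* sin t)%C.

(* W_{m,j}, the exp(2 \pi i j/r)-eigenbundle of m on TY restricted to Y^m. *)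
Definition eigenbundle (m : H) (j : nat) : vbundle R (fixpt act [set m]) :=
  vb_of (fun y => subvs_of
    (passmx.leigenspace (differential (act m) (val y)) (expi2pi j #[m]%g))).

(* The coefficients j/r make sense in k, which has characteristic 0. *)
Definition S_bundle (m : H) : Kth R k (fixpt act [set m]) :=
  \sum_(j < #[m]%g) (j%:R / #[m]%g%:R) *: Kclass k (eigenbundle m j).

(* The fiber of the normal bundle of Y^A in Y is a complement of the image of
   the tangent space of Y^A in that of Y. *)
Definition normal_bundle (A : {set H}) : vbundle R (fixpt act A) :=
  vb_of (fun y => subvs_of
    (limg (differential (val : fixpt act A -> Y) y))^C%VS).

Section Obstruction.
Variables m1 m2 : H.
Let A := <<[set m1; m2]>>%g.

Lemma e1_subproof : [set m1] \subset A.
Proof. by rewrite finset.sub1set mem_gen // !inE eqxx. Qed.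

Lemma e2_subproof : [set m2] \subset A.
Proof. by rewrite finset.sub1set mem_gen // !inE eqxx orbT. Qed.

Lemma e3_check_subproof : [set (m1 * m2)%g] \subset A.
Proof.
by rewrite finset.sub1set groupM // mem_gen // !inE eqxx ?orbT.
Qed.

Lemma e3_subproof : [set ((m1 * m2)^-1)%g] \subset A.
Proof. by rewrite finset.sub1set groupV -finset.sub1set e3_check_subproof. Qed.

Definition e1 : fixpt act A -> fixpt act [set m1] := fixpt_incl e1_subproof.
Definition e2 : fixpt act A -> fixpt act [set m2] := fixpt_incl e2_subproof.
Definition e3 : fixpt act A -> fixpt act [set ((m1 * m2)^-1)%g] :=
  fixpt_incl e3_subproof.
Definition e3_check : fixpt act A -> fixpt act [set (m1 * m2)%g] :=
  fixpt_incl e3_check_subproof.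

Definition obstruction : Kth R k (fixpt act A) :=
  Kpullback e1 (S_bundle m1) + Kpullback e2 (S_bundle m2) + Kpullback e3 (S_bundle (m1 * m2)^-1%g)
  - Kclass k (normal_bundle A).

Definition stringy_prod (v1 : Kth R k (fixpt act [set m1]))
    (v2 : Kth R k (fixpt act [set m2])) : Kth R k (fixpt act [set (m1 * m2)%g]) :=
  Kpushforward e3_check
    (Kmul (Kmul (Kpullback e1 v1) (Kpullback e2 v2)) (Eu obstruction)).

End Obstruction.

(* The direct sum of the K(Y^m), m in H. *)
Definition Kglobal := {dffun forall m : H, Kth R k (fixpt act [set m])}.

HB.instance Definition _ := Choice.on Kglobal.

Definition Kg0 : Kglobal := [ffun m : H => 0 : Kth R k (fixpt act [set m])].
Definition Kgadd (u v : Kglobal) : Kglobal := [ffun m => u m + v m].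
Definition Kgopp (u : Kglobal) : Kglobal := [ffun m => - u m].
Definition Kgscale (c : k) (u : Kglobal) : Kglobal := [ffun m => c *: u m].

Lemma KgaddA : associative Kgadd.
Proof. by move=> u v w; apply/ffunP => m; rewrite !ffunE addrA. Qed.
Lemma KgaddC : commutative Kgadd.
Proof. by move=> u v; apply/ffunP => m; rewrite !ffunE addrC. Qed.
Lemma Kgadd0 : left_id Kg0 Kgadd.
Proof. by move=> u; apply/ffunP => m; rewrite !ffunE add0r. Qed.
Lemma KgaddN : left_inverse Kg0 Kgopp Kgadd.
Proof. by move=> u; apply/ffunP => m; rewrite !ffunE addNr. Qed.

HB.instance Definition _ :=
  GRing.isZmodule.Build Kglobal KgaddA KgaddC Kgadd0 KgaddN.

Lemma KgscaleA c d u : Kgscale c (Kgscale d u) = Kgscale (c * d) u.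
Proof. by apply/ffunP => m; rewrite !ffunE scalerA. Qed.
Lemma Kgscale1 : left_id 1 Kgscale.
Proof. by move=> u; apply/ffunP => m; rewrite !ffunE scale1r. Qed.
Lemma KgscaleDr : right_distributive Kgscale +%R.
Proof. by move=> c u v; apply/ffunP => m; rewrite !ffunE scalerDr. Qed.
Lemma KgscaleDl u : {morph Kgscale^~ u : c d / c + d}.
Proof. by move=> c d; apply/ffunP => m; rewrite !ffunE scalerDl. Qed.

HB.instance Definition _ :=
  GRing.Zmodule_isLmodule.Build k Kglobal KgscaleA Kgscale1 KgscaleDr KgscaleDl.

Definition Kginj (m : H) (v : Kth R k (fixpt act [set m])) : Kglobal :=
  [ffun m' => dfwith (fun n => 0 : Kth R k (fixpt act [set n])) m v m'].

Definition Kgmul (u v : Kglobal) : Kglobal :=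
  \sum_(m1 : H) \sum_(m2 : H) Kginj (stringy_prod (u m1) (v m2)).

(* The class of the trivial line bundle in the untwisted sector m = 1. *)
Definition Kgone : Kglobal := Kginj (Kone R k (fixpt act [set 1%g])).

End Stringy.

(* Main.v *)
(* Over a finite set Y, a vector bundle is determined up to isomorphism by its
   ranks at the points of Y, so K(Y) is the algebra of functions Y -> k.
   Tangent spaces vanish, hence so do the obstruction classes, and their Euler
   classes are 1. An element u of K_global(Y, H) is then a family of scalars
   u(m, y) for m y = y, and (u * v)(m, y) is the sum over m = m1 m2 of
   u(m1, y) v(m2, y). For Y = I(pt, G), the point g is fixed by m iff g and m
   commute, and u(m, g) is the coefficient of g|_m in D(k[G])^comm.
   Characteristic 0 is used for Eu, as a class must determine the ranks of the
   bundles representing it. *)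
Require Import Defs.
From mathcomp Require Import all_boot all_order all_algebra all_fingroup all_field.
From mathcomp Require Import reals.
From HB Require Import structures.
From mathcomp Require Import finmap complex mathcomp_extra boolp classical_sets.
From mathcomp.multinomials Require Import monalg.

Set Implicit Arguments.
Unset Strict Implicit.
Unset Printing Implicit Defensive.

Import GRing.Theory.

Local Open Scope ring_scope.

(** * Ranks of bundles and short exact sequences *)

Lemma dim_Hom (F : fieldType) (U V : vectType F) :
  dim 'Hom(U, V) = (dim U * dim V)%N.
Proof. by []. Qed.

Lemma dim_regular (F : fieldType) : dim F^o = 1%N.
Proof. by []. Qed.

Lemma dim_ffun (F : fieldType) (I : finType) (V : vectType F) :
  dim {ffun I -> V} = (#|I| * dim V)%N.
Proof. by []. Qed.

Section Rank.
Variables (R : realType) (k : fieldType).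

Lemma short_exact_rank Y (E' E E'' : vbundle R Y) : short_exact E' E E'' ->
  forall y, vb_rank E y = (vb_rank E' y + vb_rank E'' y)%N.
Proof.
move=> ex y; have [i [p [i0 ip p1]]] := ex y.
have := limg_ker_dim i fullv; rewrite i0 capv0 dimv0 add0n ip.
have := limg_ker_dim p fullv; rewrite capfv p1 !dimvf !dim_matrix !mul1r.
by move=> <- <-.
Qed.

(** The split sequence v |-> (v, 0), (v, w) |-> w. Together with [short_exact_rank] it makes
    exactness a condition on ranks alone, so no bundle maps appear later. *)
Lemma short_exact_rowspace (F : fieldType) (a b c : nat) : c = (a + b)%N ->
  exists i : 'Hom('rV[F]_a, 'rV[F]_c), exists p : 'Hom('rV[F]_c, 'rV[F]_b),
    [/\ lker i = 0%VS, limg i = lker p & limg p = fullv].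
Proof.
move=> ->; exists (linfun (mulmxr (row_mx 1%:M 0))), (linfun rsubmx).
have iE (v : 'rV[F]_a) :
    linfun (mulmxr (row_mx 1%:M (0 : 'M_(a, b)))) v = row_mx v 0.
  by rewrite lfunE /= mul_mx_row mulmx1 mulmx0.
split.
- by apply/eqP/lker0P => u v; rewrite !iE => /eq_row_mx[].
- apply/vspaceP => v; rewrite memv_ker lfunE /=; apply/memv_imgP/eqP.
    by move=> [u _ ->]; rewrite iE row_mxKr.
  move=> v0; exists (lsubmx v); first exact: memvf.
  by rewrite iE -[LHS]hsubmxK v0.
- apply/vspaceP => v; rewrite memvf; apply/memv_imgP.
  by exists (row_mx 0 v); rewrite ?memvf // lfunE /= row_mxKr.
Qed.

Lemma rank_short_exact Y (E' E E'' : vbundle R Y) :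
  (forall y, vb_rank E y = (vb_rank E' y + vb_rank E'' y)%N) ->
  short_exact E' E E''.
Proof. by move=> rE y; apply: short_exact_rowspace. Qed.

Lemma eq_vbundle Y (E F : vbundle R Y) : vb_rank E =1 vb_rank F -> E = F.
Proof. by case: E F => r [s] /= /funext ->. Qed.

Lemma vb_ofE Y (V : Y -> vectType R[i]%C) y : vb_rank (vb_of V) y = dim (V y).
Proof. exact: dimvf. Qed.

Lemma dim_fiber Y (E : vbundle R Y) y : dim (E y) = vb_rank E y.
Proof. by rewrite dim_matrix mul1r. Qed.

Lemma rank_trivial Y (V : vectType R[i]%C) y :
  vb_rank (vb_trivial Y V) y = dim V.
Proof. exact: vb_ofE. Qed.

Lemma rank_pullback Z Y (f : Z -> Y) (E : vbundle R Y) z :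
  vb_rank (vb_pullback f E) z = vb_rank E (f z).
Proof. by rewrite vb_ofE dim_fiber. Qed.

Lemma rank_pushforward (Z Y : finType) (f : Z -> Y) (E : vbundle R Z) y :
  vb_rank (vb_pushforward f E) y = oapp (vb_rank E) 0%N [pick z | f z == y].
Proof.
by rewrite vb_ofE; case: pickP => [z _|_] /=; rewrite ?dim_fiber ?dim_matrix.
Qed.

Lemma rank_dual Y (E : vbundle R Y) y : vb_rank (vb_dual E) y = vb_rank E y.
Proof. by rewrite vb_ofE dim_Hom dim_fiber dim_regular muln1. Qed.

Lemma rank_tensor Y (E F : vbundle R Y) y :
  vb_rank (vb_tensor E F) y = (vb_rank E y * vb_rank F y)%N.
Proof. by rewrite vb_ofE !dim_Hom !dim_fiber dim_regular muln1. Qed.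

Lemma rank_ext0 Y (E : vbundle R Y) y : vb_rank (vb_ext 0 E) y = 1%N.
Proof.
rewrite vb_ofE dim_ffun dim_regular muln1 card_sig.
rewrite -(cards1 (finset.set0 : {set 'I_(\dim {: E y})})).
by apply: eq_card => s; rewrite !inE cards_eq0.
Qed.

(** * Classes of bundles and linear maps on K(Y) *)

Lemma Kclass_add Y (E' E E'' : vbundle R Y) :
  (forall y, vb_rank E y = (vb_rank E' y + vb_rank E'' y)%N) ->
  Kclass k E = Kclass k E' + Kclass k E''.
Proof.
move=> rE; rewrite /Kclass -KpiD; apply/Kpi_eq.
rewrite opprD addrA -[_ - _ - _]scale1r -[_ *: _]addr0.
by apply: KrelS; [exact: rank_short_exact | exact: Krel0].
Qed.

(** A bundle E of rank 0 is an extension of E by E, so its class equals twice itself. *)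
Lemma Kclass0 Y (E : vbundle R Y) :
  (forall y, vb_rank E y = 0%N) -> Kclass k E = 0.
Proof.
move=> E0; apply: (addIr (Kclass k E)); rewrite add0r -(@Kclass_add _ E E E) //.
by move=> y; rewrite !E0.
Qed.

(** A representative is a finite combination of bundles; the induction runs over its support. It
    yields [eq_Kth_linear], the tool for checking linear identities on classes only. *)
Lemma Kth_ind Y (P : Kth R k Y -> Prop) : P 0 ->
  (forall c E x, P x -> P (c *: Kclass k E + x)) -> forall x, P x.
Proof.
move=> P0 PS x; rewrite -(KreprK x); move: (Krepr x) => {}x.
rewrite [x]monalgE; elim: (enum_fset (msupp x)) => [|E s IH].
  by rewrite big_nil [Kpi _](_ : _ = 0) // /Kpi raddf0.
rewrite big_cons KpiD.
have -> : << x@_E *g E >> = x@_E *: << E >> :> {malg k[vbundle R Y]}.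
  by apply/malgP => F; rewrite mcoeffZ !mcoeffU mulr_natr.
by rewrite -KscaleE; apply: PS.
Qed.

Lemma linear_fun0 (V W : lmodType k) (f : V -> W) : linear f -> f 0 = 0.
Proof. by move=> /(_ (-1) 0 0); rewrite scaler0 addr0 scaleN1r addNr. Qed.

Lemma eq_Kth_linear Y (M : lmodType k) (f g : Kth R k Y -> M) :
  linear f -> linear g -> (forall E, f (Kclass k E) = g (Kclass k E)) -> f =1 g.
Proof.
move=> fl gl fg; elim/Kth_ind => [|c E x IH]; first by rewrite !linear_fun0.
by rewrite fl gl fg IH.
Qed.

(** * K(Y) of a finite set as the space of functions on Y *)

Section AtPoint.
Variables (Y : Type) (y : Y).

Definition Krank : Kth R k Y -> k :=
  Klift (M := k^o) (fun E => (vb_rank E y)%:R).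

Lemma Krank_additive :
  additive_on_exact (fun E : vbundle R Y => (vb_rank E y)%:R : k^o).
Proof. by move=> E' E E'' /short_exact_rank ->; rewrite natrD. Qed.

Lemma Krank_class E : Krank (Kclass k E) = (vb_rank E y)%:R.
Proof. exact: Klift_class Krank_additive E. Qed.

Lemma Krank_linear : linear (Krank : _ -> k^o).
Proof. exact: Klift_linear Krank_additive. Qed.

HB.instance Definition _ :=
  GRing.isLinear.Build k (Kth R k Y) k^o _ Krank Krank_linear.
End AtPoint.

Lemma additive_on_rank (M : lmodType k) Y (phi : vbundle R Y -> M) :
  (forall E' E E'',
     (forall y, vb_rank E y = (vb_rank E' y + vb_rank E'' y)%N) ->
     phi E = phi E' + phi E'') -> additive_on_exact phi.
Proof. by move=> phiD E' E E'' /short_exact_rank /phiD. Qed.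

Definition vb_skyscraper (Y : finType) (y : Y) : vbundle R Y :=
  VBundle R (fun z => z == y).

(** Any E is the direct sum over y of [vb_rank E y] copies of the skyscraper at y. Both the
    multiples ([nP]) and the sum over points ([sP]) are realized by actual bundles, adding one
    summand at a time. *)
Lemma Kclass_skyscraper (Y : finType) (E : vbundle R Y) :
  Kclass k E = \sum_y (vb_rank E y)%:R *: Kclass k (vb_skyscraper y).
Proof.
have nP (n : nat) (y : Y) : n%:R *: Kclass k (vb_skyscraper y) =
    Kclass k (VBundle R (fun z => n * (z == y))%N).
  elim: n => [|n IH]; first by rewrite scale0r Kclass0.
  rewrite -natr1 scalerDl IH scale1r.
  by apply/esym/Kclass_add => z /=; rewrite mulSn addnC.
have sP (s : seq Y) :
    \sum_(y <- s) (vb_rank E y)%:R *: Kclass k (vb_skyscraper y) =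
    Kclass k (VBundle R (fun z => \sum_(y <- s) vb_rank E y * (z == y))%N).
  elim: s => [|y s IH].
    by rewrite big_nil Kclass0 // => y /=; rewrite big_nil.
  by rewrite big_cons IH nP; apply/esym/Kclass_add => z /=; rewrite big_cons.
rewrite sP; congr Kclass; apply: eq_vbundle => z /=.
rewrite (bigD1 z) //= eqxx muln1 big1 ?addn0 // => y /negPf.
by rewrite eq_sym => ->; rewrite muln0.
Qed.

Lemma Kth_skyscraper (Y : finType) (x : Kth R k Y) :
  x = \sum_y Krank y x *: Kclass k (vb_skyscraper y).
Proof.
move: x; apply: (@eq_Kth_linear _ _ id) => [//|c x y|E].
  rewrite scaler_sumr -big_split; apply: eq_bigr => z _.
  by rewrite linearP scalerDl scalerA.
by rewrite {1}Kclass_skyscraper; apply: eq_bigr => y _; rewrite Krank_class.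
Qed.

Lemma Krank_inj (Y : finType) (x x' : Kth R k Y) :
  (forall y, Krank y x = Krank y x') -> x = x'.
Proof.
move=> xx'; rewrite (Kth_skyscraper x) (Kth_skyscraper x').
by apply: eq_bigr => y _; rewrite xx'.
Qed.

Lemma Krank_sum_skyscraper (Y : finType) (a : Y -> k) (y : Y) :
  Krank y (\sum_z a z *: Kclass k (vb_skyscraper z)) = a y.
Proof.
rewrite linear_sum (bigD1 y) //= big1 ?addr0 => [|z /negPf zy].
  by rewrite linearZ /= Krank_class /= eqxx; apply: mulr1.
by rewrite linearZ /= Krank_class /= eq_sym zy; apply: mulr0.
Qed.

(** * Pullback, pushforward, product and Euler class in terms of ranks *)

Lemma Krank_pullback Z Y (f : Z -> Y) z (x : Kth R k Y) :
  Krank z (Kpullback f x) = Krank (f z) x.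
Proof.
have fD : additive_on_exact (fun E : vbundle R Y => Kclass k (vb_pullback f E)).
  by apply: additive_on_rank => E' E E'' rE; apply: Kclass_add => y;
    rewrite !rank_pullback.
move: x; apply: (@eq_Kth_linear _ k^o) => [c x y||E].
- by rewrite [Kpullback _ _](Klift_linear fD) linearP.
- exact: Krank_linear.
by rewrite [Kpullback _ _](Klift_class fD) !Krank_class rank_pullback.
Qed.

Lemma Krank_pushforward (Z Y : finType) (f : Z -> Y) y (x : Kth R k Z) :
  Krank y (Kpushforward f x) = oapp (fun z => Krank z x) 0 [pick z | f z == y].
Proof.
have fD :
    additive_on_exact (fun E : vbundle R Z => Kclass k (vb_pushforward f E)).
  by apply: additive_on_rank => E' E E'' rE; apply: Kclass_add => z;
    rewrite !rank_pushforward; case: pickP => //=.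
move: x; apply: (@eq_Kth_linear _ k^o) => [c u v|c u v|E].
- by rewrite [Kpushforward _ _](Klift_linear fD) linearP.
- by case: pickP => [z _|_] /=; rewrite ?linearP // scaler0 addr0.
rewrite [Kpushforward _ _](Klift_class fD) Krank_class rank_pushforward.
by case: pickP => [z _|_] //=; rewrite Krank_class.
Qed.

Lemma Krank_mul Y (y : Y) (u v : Kth R k Y) :
  Krank y (Kmul u v) = Krank y u * Krank y v.
Proof.
(* [Kmul] is a lift nested in a lift: [tD] and [mD] are the additivity of the inner and of the outer
   one, without which neither can be evaluated on classes. *)
have tD E : additive_on_exact (fun F : vbundle R Y => Kclass k (vb_tensor E F)).
  by apply: additive_on_rank => F' F F'' rF; apply: Kclass_add => z;
    rewrite !rank_tensor rF mulnDr.
have mD :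
    additive_on_exact (fun E => Klift (fun F => Kclass k (vb_tensor E F)) v).
  apply: additive_on_rank => E' E E'' rE.
  move: v; apply: eq_Kth_linear => [||F]; first exact: Klift_linear.
    by move=> c x x'; rewrite !(Klift_linear (tD _)) scalerDr addrACA.
  by rewrite !(Klift_class (tD _)); apply: Kclass_add => z;
    rewrite !rank_tensor rE mulnDl.
move: u; apply: (@eq_Kth_linear _ k^o) => [c u u'|c u u'|E].
- by rewrite [Kmul _ _](Klift_linear mD) linearP.
- by rewrite linearP mulrDl scalerAl.
rewrite [Kmul _ _](Klift_class mD) Krank_class.
move: v {mD}; apply: (@eq_Kth_linear _ k^o) => [c v v'|c v v'|F].
- by rewrite (Klift_linear (tD _)) linearP.
- by rewrite linearP mulrDr scalerAr.
by rewrite (Klift_class (tD _)) !Krank_class rank_tensor natrM.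
Qed.

Lemma Krank_one Y (y : Y) : Krank y (Kone R k Y) = 1.
Proof. by rewrite Krank_class rank_trivial dim_regular. Qed.

Lemma Krank_Eu0 (Y : finType) (y : Y) : [pchar k] =i pred0 ->
  Krank y (Eu (0 : Kth R k Y)) = 1.
Proof.
move=> /pcharf0P k0; rewrite /Eu; set E := xget _ _.
(* The bundle chosen by [xget] has class 0, so its ranks vanish in k, and in characteristic 0 they
   vanish as natural numbers. The zero bundle shows that there is a bundle to choose. *)
have E0 z : vb_rank E z = 0%N.
  apply/eqP; rewrite -k0 -Krank_class.
  suff -> : Kclass k E = 0 by rewrite raddf0.
  by apply: (@xgetPex _ _ [set F | Kclass k F = 0]%classic);
    exists (vb_trivial Y 'rV[R[i]%C]_0);
    apply: Kclass0 => z'; rewrite rank_trivial.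
(* Only the exterior power of degree 0 is left in the alternating sum, and it has rank 1. *)
rewrite /lambda_m1 (_ : \max_z _ = 0)%N; last first.
  by apply: big1 => z _; rewrite dimvf dim_fiber rank_dual.
by rewrite big_ord1 scale1r Krank_class rank_ext0.
Qed.

End Rank.

(** * The stringy product over a finite set *)

Section StringyRank.
Variables (R : realType) (k : fieldType) (H : finGroupType) (Y : finType).
Variable act : laction H Y.
Local Notation Kfix A := (Kth R k (fixpt act A)).

Lemma val_fixpt_inj (A : {set H}) : injective (val : fixpt act A -> Y).
Proof. exact: val_inj. Qed.

Lemma fixptP (A : {set H}) y : (forall h, h \in A -> act h y = y) ->
  exists z : fixpt act A, val z = y.
Proof.
move=> Ay; have yP : [forall h in A, act h y == y].
  by apply/forall_inP => h /Ay ->.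
by exists (exist _ y yP).
Qed.

Lemma fixpt_act (A : {set H}) (z : fixpt act A) h : h \in A ->
  act h (val z) = val z.
Proof. by move=> hA; have /forall_inP/(_ h hA)/eqP := valP z. Qed.

(** The stabilizer of y is a group, so it contains the group generated by m1 and m2. *)
Lemma fixpt_gen2 (m1 m2 : H) y : act m1 y = y -> act m2 y = y ->
  exists z : fixpt act <<[set m1; m2]>>%g, val z = y.
Proof.
move=> y1 y2; pose S := [set h | act h y == y].
have gS : group_set S.
  apply/group_setP; split=> [|g h]; first by rewrite inE lact1.
  by rewrite !inE lactM => /eqP gy /eqP ->; rewrite gy.
have : <<[set m1; m2]>>%g \subset Group gS.
  rewrite gen_subG; apply/fintype.subsetP => h /set2P[]->;
    by rewrite inE ?y1 ?y2.
move=> /fintype.subsetP sS; apply: fixptP => h /sS.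
by rewrite inE => /eqP.
Qed.

Lemma dim_tangent_subvs (U : {vspace tangent R}) : dim (subvs_of U) = 0%N.
Proof.
apply/eqP; rewrite -leqn0 [X in (X <= _)%N](_ : _ = \dim U) //.
by rewrite (leq_trans (dimvS (subvf U))) // dimvf dim_matrix mulr0.
Qed.

Lemma S_bundle0 m : S_bundle R k act m = 0.
Proof.
apply: big1 => j _; rewrite Kclass0 ?scaler0 // => y.
by rewrite vb_ofE dim_tangent_subvs.
Qed.

Lemma normal_bundle0 (A : {set H}) : Kclass k (normal_bundle R act A) = 0.
Proof. by apply: Kclass0 => y; rewrite vb_ofE dim_tangent_subvs. Qed.

Lemma Kpullback0 (Z Z' : finType) (f : Z -> Z') :
  Kpullback f (0 : Kth R k Z') = 0.
Proof. by apply: Krank_inj => z; rewrite Krank_pullback !raddf0. Qed.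

Lemma obstruction0 m1 m2 : obstruction R k act m1 m2 = 0.
Proof.
by rewrite /obstruction !S_bundle0 normal_bundle0 !Kpullback0 !addr0 subrr.
Qed.

(** The rank function extended by zero from the fixed locus to Y, so that elements of different
    sectors can be compared at the same point. *)
Definition Krank_at (A : {set H}) (v : Kfix A) (y : Y) : k :=
  if [pick z : fixpt act A | val z == y] is Some z then Krank z v else 0.

Lemma Krank_at_val (A : {set H}) (v : Kfix A) z :
  Krank_at v (val z) = Krank z v.
Proof.
rewrite /Krank_at; case: pickP => [z' /eqP /val_fixpt_inj -> //|/(_ z)].
by rewrite eqxx.
Qed.

Lemma Krank_at_out (A : {set H}) (v : Kfix A) y :
  (forall z : fixpt act A, val z <> y) -> Krank_at v y = 0.
Proof. by move=> yN; rewrite /Krank_at; case: pickP => // z /eqP /yN. Qed.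

Lemma Krank_at_linear (A : {set H}) y :
  linear (fun v : Kfix A => Krank_at v y : k^o).
Proof.
move=> c u v; rewrite /Krank_at.
case: pickP => [z _|_]; last by rewrite scaler0 addr0.
exact: Krank_linear.
Qed.

Hypothesis chark0 : [pchar k] =i pred0.

(* If y is fixed by m1 m2 but not by both m1 and m2, then the left-hand side
   vanishes because the pushforward extends by zero. *)
Lemma Krank_at_stringy m1 m2 (v1 : Kfix [set m1]) (v2 : Kfix [set m2]) y :
  Krank_at (stringy_prod v1 v2) y = Krank_at v1 y * Krank_at v2 y.
Proof.
have [[z <-]|yN] :=
  pselect (exists z : fixpt act <<[set m1; m2]>>%g, val z = y).
  rewrite [LHS](Krank_at_val _ (e3_check z)).
  rewrite [Krank_at v1 _](Krank_at_val _ (e1 z)).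
  rewrite [Krank_at v2 _](Krank_at_val _ (e2 z)).
  rewrite Krank_pushforward; case: pickP => [z'|/(_ z)]; last by rewrite eqxx.
  (* The preimage picked by the pushforward is z itself, since the inclusions are injective. *)
  move=> /eqP/(congr1 val)/= /val_fixpt_inj -> /=.
  by rewrite !Krank_mul !Krank_pullback obstruction0 Krank_Eu0 // mulr1.
have -> : Krank_at (stringy_prod v1 v2) y = 0.
  rewrite /Krank_at; case: pickP => // z /eqP zy.
  rewrite Krank_pushforward; case: pickP => //= z' /eqP zz'.
  by case: yN; exists z'; rewrite -zy -zz'.
have [y1|y1] := eqVneq (act m1 y) y; last first.
  rewrite [Krank_at v1 y]Krank_at_out ?mul0r // => z zy.
  by move: y1; rewrite -zy fixpt_act ?inE ?eqxx.
rewrite [Krank_at v2 y]Krank_at_out ?mulr0 // => z zy; apply: yN.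
by apply: fixpt_gen2 => //; rewrite -zy fixpt_act // inE.
Qed.

Definition Kgrank m y (u : Kglobal R k act) : k := Krank_at (u m) y.

Lemma Kgrank_linear m y : linear (Kgrank m y : _ -> k^o).
Proof. by move=> c u v; rewrite /Kgrank !ffunE Krank_at_linear. Qed.

HB.instance Definition _ m y :=
  GRing.isLinear.Build k (Kglobal R k act) k^o _
    (Kgrank m y) (@Kgrank_linear m y).

Lemma Kgrank_inj (u v : Kglobal R k act) :
  (forall m y, act m y = y -> Kgrank m y u = Kgrank m y v) -> u = v.
Proof.
move=> uv; apply/ffunP => m; apply: Krank_inj => z.
by rewrite -!Krank_at_val; apply: uv; rewrite fixpt_act ?inE.
Qed.

Lemma Kgrank_out m y u : act m y <> y -> Kgrank m y u = 0.
Proof.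
move=> my; apply: Krank_at_out => z zy; apply: my.
by rewrite -zy fixpt_act ?inE.
Qed.

Lemma Kgrank_Kginj m m' (v : Kfix [set m]) y :
  Kgrank m' y (Kginj v) = if m == m' then Krank_at v y else 0.
Proof.
rewrite /Kgrank /Kginj ffunE; have [<-|mm'] := eqVneq m m'.
  by rewrite mathcomp_extra.dfwithin.
by rewrite mathcomp_extra.dfwithout // (linear_fun0 (Krank_at_linear _)).
Qed.

Lemma Kgrank_mul (u v : Kglobal R k act) m y :
  Kgrank m y (Kgmul u v) = \sum_x Kgrank x y u * Kgrank (x^-1 * m)%g y v.
Proof.
rewrite linear_sum; apply: eq_bigr => x _ /=.
(* For fixed m1 = x, the sector m receives a contribution only from m2 = x^-1 m. *)
rewrite linear_sum /= (bigD1 (x^-1 * m)%g) //= big1 ?addr0 => [|h hN].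
  by rewrite Kgrank_Kginj Krank_at_stringy ifT // mulKVg.
rewrite Kgrank_Kginj ifN //; apply: contraNneq hN => <-.
by rewrite mulKg.
Qed.

Lemma Kgrank_one m y : Kgrank m y (Kgone R k act) = (m == 1%g)%:R.
Proof.
rewrite Kgrank_Kginj eq_sym; case: eqP => // _.
have [|z <-] := @fixptP [set 1%g] y; first by move=> h /set1P ->; rewrite lact1.
by rewrite Krank_at_val Krank_one.
Qed.

(** The element with prescribed coordinates: values of a at pairs with m y different from y are
    discarded. It provides the inverse of the isomorphism. *)
Definition Kg_of (a : H -> Y -> k) : Kglobal R k act :=
  [ffun m => \sum_(z : fixpt act [set m])
     a m (val z) *: Kclass k (vb_skyscraper R z)].

Lemma Kgrank_of a m y : act m y = y -> Kgrank m y (Kg_of a) = a m y.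
Proof.
move=> my; have [|z <-] := @fixptP [set m] y; first by move=> h /set1P ->.
by rewrite /Kgrank Krank_at_val ffunE Krank_sum_skyscraper.
Qed.

End StringyRank.

(** * The isomorphism with the commuting part of the Drinfel'd double *)

Section GlobalToDrinfeld.
Variables (R : realType) (k : fieldType) (G : finGroupType).
Hypothesis chark0 : [pchar k] =i pred0.
Local Notation act := (inertia_laction (trivial_laction G unit)).
Local Notation K := (Kglobal R k act).

Definition inertia_pt (g : G) : inertia (trivial_laction G unit) :=
  exist _ (g, tt) (eqxx tt).

Lemma inertia_ptK (y : inertia (trivial_laction G unit)) :
  inertia_pt (val y).1 = y.
Proof. by apply: val_inj; case: y => -[g []] yP. Qed.

(** The element x moves the point g to x g x^-1. Hence the support condition on K_global is the
    commutation condition defining [dcomm]. *)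
Lemma fix_inertia_pt g x :
  (act x (inertia_pt g) == inertia_pt g) = (g * x == x * g)%g.
Proof.
rewrite -(inj_eq val_inj) xpair_eqE eqxx andbT /= conjgE invgK eq_sym.
by rewrite -(inj_eq (mulIg x)) mulgA mulgVK.
Qed.

Definition to_drinfeld (u : K) : drinfeld k G :=
  [ffun p => Kgrank p.2 (inertia_pt p.1) u].

Lemma to_drinfeld_linear : linear to_drinfeld.
Proof. by move=> c u v; apply/ffunP => p; rewrite !ffunE Kgrank_linear. Qed.

Lemma to_drinfeld_comm u : to_drinfeld u \in dcomm k G.
Proof.
apply/mem_dcomm => g x gx; rewrite ffunE Kgrank_out //.
by apply/eqP; rewrite fix_inertia_pt.
Qed.

Lemma to_drinfeldM u v :
  to_drinfeld (Kgmul u v) = to_drinfeld u * to_drinfeld v.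
Proof.
apply/ffunP => -[g m]; rewrite [RHS]dmulE ffunE Kgrank_mul //.
apply: eq_bigr => x _; rewrite ![in RHS]ffunE /=.
(* The product in D evaluates the second factor at g ^ x, the stringy product at g. These agree if x
   and g commute; otherwise the coefficient of the first factor is 0. *)
have [/eqP|gx] := eqVneq (g * x)%g (x * g)%g.
  by rewrite conjgE => /eqP ->; rewrite mulKg.
by rewrite Kgrank_out ?mul0r //; apply/eqP; rewrite fix_inertia_pt.
Qed.

Lemma to_drinfeld1 : to_drinfeld (Kgone R k act) = 1.
Proof. by apply/ffunP => -[g m]; rewrite [RHS]dunitE ffunE Kgrank_one. Qed.

Definition to_dcomm (u : K) : subvs_of (dcomm k G) :=
  vsproj (dcomm k G) (to_drinfeld u).

Lemma to_dcommE u : vsval (to_dcomm u) = to_drinfeld u.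
Proof. by rewrite vsprojK ?to_drinfeld_comm. Qed.

Lemma to_dcomm_linear : linear to_dcomm.
Proof. by move=> c u v; rewrite /to_dcomm to_drinfeld_linear linearP. Qed.

HB.instance Definition _ :=
  GRing.isLinear.Build k K (subvs_of (dcomm k G)) _ to_dcomm to_dcomm_linear.

Lemma to_dcomm_bij : bijective to_dcomm.
Proof.
exists (fun a : subvs_of (dcomm k G) => @Kg_of R k G _ act (fun m y =>
  (vsval a : drinfeld k G) ((val y).1, m))) => [u|a].
  apply: Kgrank_inj => m y my; rewrite Kgrank_of // to_dcommE ffunE /=.
  by rewrite inertia_ptK.
apply: val_inj; rewrite /= to_dcommE; apply/ffunP => -[g m]; rewrite ffunE /=.
(* At non-commuting pairs both sides vanish: the left one by [Kgrank_out], the right one by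
   membership in [dcomm]. *)
have [gm|gm] := boolP (act m (inertia_pt g) == inertia_pt g).
  by rewrite Kgrank_of //; apply/eqP.
rewrite Kgrank_out; last exact/eqP.
by rewrite (mem_dcomm _ (subvsP a)) // -fix_inertia_pt.
Qed.

End GlobalToDrinfeld.

Theorem proposition3p10 (R : realType) (k : fieldType)
  (chark0 : [pchar k] =i pred0) (G : finGroupType) :
  exists f : {linear Kglobal R k (inertia_laction (trivial_laction G unit))
                     -> subvs_of (dcomm k G)},
    [/\ bijective f, f (Kgone R k _) = 1 &
        forall u v, f (Kgmul u v) = f u * f v].
Proof.
(* The unit of the subalgebra is its own [algid]; it equals the unit of D because the latter lies in
   [dcomm], being the image of [Kgone]. *)
have d1 : 1 \in dcomm k G.
  by rewrite -(to_drinfeld1 R); apply: to_drinfeld_comm.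
exists (@to_dcomm R k G); split; first exact: to_dcomm_bij.
  apply: val_inj; rewrite /= to_dcommE to_drinfeld1.
  by apply/esym/eqP; rewrite [_ == _](algid_eq1 (dcomm k G)).
by move=> u v; apply: val_inj; rewrite /= !to_dcommE to_drinfeldM.
Qed.
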